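(* Let $d\ge 2$, let $F:\mathbb{R}^d\to\mathbb{R}^d$ be bi-Lipschitz continuous, let $n\ge 2$ be an integer, $N=n^d$, and let $\{(x^\alpha,y^\alpha)\}_{\alpha\in[n-1]^d}$ be the finite collection of evaluations $x^\alpha=\frac{\alpha}{n}$, $y^\alpha=F(x^\alpha)$. Then for any tolerance $\epsilon>0$ there exists a bi-Lipschitz continuous invertible mapping $\tilde F_{\rm nn}\in\mathcal{A}_{\mathcal{F}}$ such that $\|\tilde F_{\rm nn}(x^\alpha)-y^\alpha\|_2<\epsilon$ for any $\alpha\in[n-1]^d$, and the Lipschitz constants $L_{\tilde F_{\rm nn}}$ of $\tilde F_{\rm nn}$ and $L_{\tilde F_{\rm nn}^{-1}}$ of $\tilde F_{\rm nn}^{-1}$ are bounded by $$L_{\tilde F_{\rm nn}}\le \frac{n}{n-1}(1+6Nc)(1+2N\epsilon)(1+6N\epsilon^{-1}c),$$ $$L_{\tilde F_{\rm nn}^{-1}}\le \frac{n}{n-1}(1+6Nc)(1+2N\epsilon)(1+6N\epsilon^{-1}c),$$ with $c:=\max_{\alpha\in[n-1]^d}\|y^{\alpha}-x^{\alpha}\|_2+n^{-1}$.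
   Context: For $m\in\mathbb{N}$, $[m]=\{0,1,\dots,m\}$, so $[n-1]^d=\{0,\dots,n-1\}^d$. $\|\cdot\|_2$ is the Euclidean norm. A map $F:\mathbb{R}^d\to\mathbb{R}^d$ is bi-Lipschitz if it is invertible and both $F$ and $F^{-1}$ are Lipschitz continuous. Let $\sigma(t)=\max(0,t)$ be the ReLU function, applied componentwise to vectors. The control family is $$\mathcal{F}:=\{x\mapsto V\sigma(W^{(2)}\sigma(W^{(1)}x+b^{(1)})+b^{(2)})\;|\;V,W^{(1)},W^{(2)}\in\mathbb{R}^{d\times d},\ b^{(1)},b^{(2)}\in\mathbb{R}^d\}.$$ For $f\in\mathcal{F}$ and $\tau>0$, $\psi^f_\tau:\mathbb{R}^d\to\mathbb{R}^d$ is the flow map $\psi^f_\tau(x)=y(\tau)$, where $y$ is the unique solution of $\frac{{\rm d}y}{{\rm d}t}=f(y)$, $t>0$, $y(0)=x$. The attainable set is $$\mathcal{A}_{\mathcal{F}}:=\bigcup_{T>0}\Big\{\psi^{f_k}_{\tau_k}\circ\cdots\circ\psi^{f_1}_{\tau_1}\;\Big|\;k\ge1,\ f_j\in\mathcal{F},\ \tau_j>0\ \forall j=1,\dots,k,\ \sum_{j=1}^k\tau_j=T\Big\}.$$ *)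

(* Defs.v *)
From mathcomp Require Import all_boot all_order all_algebra.
From mathcomp Require Import all_classical all_reals all_analysis.

Set Implicit Arguments.
Unset Strict Implicit.
Unset Printing Implicit Defensive.

Import Order.TTheory GRing.Theory Num.Theory numFieldNormedType.Exports.

Local Open Scope classical_set_scope.
Local Open Scope ring_scope.

(* The norm that the library puts on matrices is the sup norm, which gives the
   same topology and derivatives but not the same Lipschitz constants. *)
Definition norm2 {R : realType} {d : nat} (x : 'cV[R]_d) : R :=
  Num.sqrt (\sum_i (x i 0) ^+ 2).

Definition lipschitz_with {R : realType} {d : nat} (L : R)
    (F : 'cV[R]_d -> 'cV[R]_d) : Prop :=
  forall x y, norm2 (F x - F y) <= L * norm2 (x - y).

Definition lipschitz_cont {R : realType} {d : nat}
    (F : 'cV[R]_d -> 'cV[R]_d) : Prop :=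
  exists L : R, lipschitz_with L F.

(* [inf] of the empty set is 0, so this is meaningful only for F Lipschitz. *)
Definition lipschitz_const {R : realType} {d : nat}
    (F : 'cV[R]_d -> 'cV[R]_d) : R :=
  inf [set L : R | 0 <= L /\ lipschitz_with L F].

Definition bilipschitz_pair {R : realType} {d : nat}
    (F G : 'cV[R]_d -> 'cV[R]_d) : Prop :=
  [/\ cancel F G, cancel G F, lipschitz_cont F & lipschitz_cont G].

Definition bilipschitz {R : realType} {d : nat}
    (F : 'cV[R]_d -> 'cV[R]_d) : Prop :=
  exists G, bilipschitz_pair F G.

Definition relu {R : realType} (t : R) : R := Num.max 0 t.

Definition control_family {R : realType} {d : nat} :
    set ('cV[R]_d -> 'cV[R]_d) :=
  [set f | exists (V W1 W2 : 'M[R]_d) (b1 b2 : 'cV[R]_d),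
     f = fun x => V *m map_mx relu (W2 *m map_mx relu (W1 *m x + b1) + b2)].

(* Values of y at negative times are irrelevant; since the equation is imposed
   only for t > 0, the initial condition needs y continuous on [0, +oo[. *)
Definition solves_ode {R : realType} {d : nat} (f : 'cV[R]_d -> 'cV[R]_d)
    (x : 'cV[R]_d) (y : R -> 'cV[R]_d) : Prop :=
  [/\ y 0 = x, {within `[0, +oo[, continuous y}
    & forall t : R, 0 < t -> is_derive t 1 y (f (y t))].

(* For Lipschitz f, in particular f in [control_family], the solution exists
   and is unique on [0, +oo[, so this determines psi. *)
Definition is_flow_map {R : realType} {d : nat} (f : 'cV[R]_d -> 'cV[R]_d)
    (tau : R) (psi : 'cV[R]_d -> 'cV[R]_d) : Prop :=
  forall x, exists y : R -> 'cV[R]_d, solves_ode f x y /\ psi x = y tau.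

(* Composes in order of increasing index: psi_{k-1} \o ... \o psi_0. *)
Definition compose_all {T : Type} {k : nat} (psi : 'I_k -> T -> T) : T -> T :=
  \big[(fun g h => h \o g)/idfun]_(j < k) psi j.

Definition attainable {R : realType} {d : nat}
    (A : set ('cV[R]_d -> 'cV[R]_d)) : set ('cV[R]_d -> 'cV[R]_d) :=
  \bigcup_(T in [set T : R | 0 < T])
    [set phi | exists (k : nat) (f : 'I_k -> 'cV[R]_d -> 'cV[R]_d)
                      (tau : 'I_k -> R) (psi : 'I_k -> 'cV[R]_d -> 'cV[R]_d),
       [/\ (1 <= k)%N,
           forall j, [/\ A (f j), 0 < tau j & is_flow_map (f j) (tau j) (psi j)],
           \sum_j tau j = T
         & phi = compose_all psi]].

Definition grid_point (R : realType) (d n : nat)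
    (alpha : {ffun 'I_d -> 'I_n}) : 'cV[R]_d :=
  \col_i ((alpha i)%:R / n%:R).

(* The index set is nonempty for n > 0 and norms are nonnegative, so the
   default value 0 of the iterated maximum plays no role. *)
Definition max_displacement {R : realType} {d : nat} (n : nat)
    (F : 'cV[R]_d -> 'cV[R]_d) : R :=
  \big[Num.max/0]_(alpha : {ffun 'I_d -> 'I_n})
    norm2 (F (grid_point R alpha) - grid_point R alpha).

(* Main.v *)
(* A field [s(x) v] whose scalar factor [s] is a difference of two neurons that
   do not vary along [v] has flow map [x + tau s(x) v]. Summing such ramps in a
   coordinate [x_i] gives every shear [x + g(x_i)] with [g] piecewise linear and
   [g_i = 0]; if [g] is [K]-Lipschitz, the shear and its inverse are
   [(1 + K)]-Lipschitz. Three shears suffice: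
   - adding [sum_(j >= 1) x_j / n^j] to [x_0] makes the coordinates 0 of the grid
     points distinct multiples of [1 / N];
   - driven by [x_0], all other coordinates are moved to those of [y], except
     that coordinate 1 is perturbed by at most [eps / 3] so that its values
     become [eps / (3 N)]-separated;
   - driven by [x_1], coordinate 0 is moved to that of [y]. *)
Require Import Defs.
From mathcomp Require Import all_boot all_order all_algebra.
From mathcomp Require Import all_classical all_reals all_analysis.
From mathcomp Require Import ring lra.

Set Implicit Arguments.
Unset Strict Implicit.
Unset Printing Implicit Defensive.

Import Order.TTheory GRing.Theory Num.Theory numFieldNormedType.Exports.

Local Open Scope classical_set_scope.
Local Open Scope ring_scope.

(** * Closure of the attainable set under composition *)

Lemma attainable_cons (R : realType) (d : nat)
    (A : set ('cV[R]_d -> 'cV[R]_d)) (f psi phi : 'cV[R]_d -> 'cV[R]_d)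
    (tau : R) :
  A f -> 0 < tau -> is_flow_map f tau psi -> attainable A phi ->
  attainable A (phi \o psi).
Proof.
move=> Af tau_gt0 psiP [T /= T_gt0 [k [fs [taus [psis [k1 Hj HT ->]]]]]].
(* [ext] prepends an entry to a finite family. Index 0 is the right place for [psi], because
   [compose_all] applies index 0 first. *)
pose ext U (x0 : U) (xs : 'I_k -> U) (j : 'I_k.+1) :=
  if unlift ord0 j is Some i then xs i else x0.
have ext0 U x0 xs : ext U x0 xs ord0 = x0 by rewrite /ext unlift_none.
have extS U x0 xs j : ext U x0 xs (lift ord0 j) = xs j by rewrite /ext liftK.
exists (tau + T) => /=; first by rewrite addr_gt0.
exists k.+1, (ext _ f fs), (ext _ tau taus), (ext _ psi psis); split => //.
- by move=> j; rewrite /ext; case: unliftP => [i _|_]; [exact: Hj|].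
- rewrite big_ord_recl ext0 -HT; congr (_ + _).
  by apply: eq_bigr => i _; rewrite extS.
- rewrite /compose_all big_ord_recl ext0; congr (_ \o _).
  by apply: eq_bigr => i _; rewrite extS.
Qed.

Lemma attainable_flow (R : realType) (d : nat)
    (A : set ('cV[R]_d -> 'cV[R]_d)) (f psi : 'cV[R]_d -> 'cV[R]_d)
    (tau : R) :
  A f -> 0 < tau -> is_flow_map f tau psi -> attainable A psi.
Proof.
move=> Af tau_gt0 psiP; exists tau => //=.
exists 1%N, (fun=> f), (fun=> tau), (fun=> psi); split => //.
- by rewrite big_ord1.
- by rewrite /compose_all big_ord_recl big_ord0.
Qed.

Lemma attainable_comp (R : realType) (d : nat)
    (A : set ('cV[R]_d -> 'cV[R]_d)) (phi chi : 'cV[R]_d -> 'cV[R]_d) :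
  attainable A phi -> attainable A chi -> attainable A (chi \o phi).
Proof.
move=> [_ _ [k [f [tau [psi [_ Hj _ ->]]]]]] chiP.
(* The flow applied first is peeled off, as [attainable_cons] requires; the empty composition leaves
   [chi] itself. *)
elim: k f tau psi Hj => [|k IH] f tau psi Hj.
  by rewrite /compose_all big_ord0.
rewrite /compose_all big_ord_recl compA.
have [Af tau_gt0 psiP] := Hj ord0.
apply: attainable_cons Af tau_gt0 psiP _.
by apply: (IH (fun j => f (lift ord0 j)) (fun j => tau (lift ord0 j))) => j.
Qed.

(** * Shears as flow maps *)

(** Two hidden neurons carry the two ReLU terms, and the matching columns of [V] are [v] and [- v];
    there is room for them in dimension at least 2. The second layer can be the identity because
    ReLU is idempotent. *)
Lemma shear_in_control_family (R : realType) (d : nat) (p q : 'rV[R]_d.+2)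
    (a b : R) (v : 'cV[R]_d.+2) :
  control_family (fun x => (relu ((p *m x) 0 0 + a) -
                            relu ((q *m x) 0 0 + b)) *: v).
Proof.
pose sel (U : Type) (u w z : U) (i : 'I_d.+2) :=
  match val i with 0%N => u | 1%N => w | _ => z end.
pose V : 'M[R]_d.+2 := \matrix_(i, j) sel _ (v i 0) (- v i 0) 0 j.
exists V, (\matrix_(i, j) sel _ (p 0 j) (q 0 j) 0 i), 1%:M,
  (\col_i sel _ a b 0 i), 0.
have VE (z : 'cV[R]_d.+2) : V *m z = (z ord0 0 - z (lift ord0 ord0) 0) *: v.
  apply/matrixP => i j; rewrite ord1 {j} !mxE 2!big_ord_recl big1 => [|j _].
    by rewrite !mxE /sel /=; ring.
  by rewrite mxE mul0r.
have reluK (t : R) : relu (relu t) = relu t.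
  by rewrite /relu; apply/max_idPr; rewrite le_max lexx.
apply/funext => x; rewrite VE mul1mx addr0; congr (_ *: _).
rewrite !mxE !reluK /=.
by congr (relu (_ + _) - relu (_ + _)); apply: eq_bigr => j _; rewrite mxE.
Qed.

(* The field is constant along its trajectories, so these are straight lines. *)
Lemma attainable_shear (R : realType) (d : nat) (p q : 'rV[R]_d.+2)
    (a b : R) (v : 'cV[R]_d.+2) :
  p *m v = 0 -> q *m v = 0 ->
  attainable control_family
    (fun x => x + (relu ((p *m x) 0 0 + a) - relu ((q *m x) 0 0 + b)) *: v).
Proof.
move=> pv0 qv0; apply: (attainable_flow _ ltr01).
  exact: (shear_in_control_family p q a b v).
move=> x; set f := (fun _ => _ *: v).
exists (fun t => x + t *: f x); split; last by rewrite scale1r.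
have dy (t : R) : is_derive t 1 (fun t => x + t *: f x) (f x).
  have dscale : is_derive t 1 ( *:%R^~ (f x)) (f x).
    apply: DeriveDef; first exact/diff_derivable/ex_diff.
    by rewrite deriveE ?diff_val ?scale1r //; exact: ex_diff.
  by have := is_deriveD (is_derive_cst x t 1) dscale; rewrite add0r.
split.
- by rewrite scale0r addr0.
- apply: continuous_subspaceT => t; apply: cvgD; first exact: cvg_cst.
  exact: scalel_continuous.
- move=> t _; have -> : f (x + t *: f x) = f x; last exact: dy.
  rewrite /f; congr ((relu _ - relu _) *: _); rewrite scalerA mulmxDr -scalemxAr.
    by rewrite pv0 scaler0 addr0.
  by rewrite qv0 scaler0 addr0.
Qed.

(** * Euclidean norm *)

Lemma norm2_ge0 (R : realType) (d : nat) (x : 'cV[R]_d) : 0 <= norm2 x.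
Proof. exact: sqrtr_ge0. Qed.

Lemma norm2_sqr (R : realType) (d : nat) (x : 'cV[R]_d) :
  norm2 x ^+ 2 = \sum_i (x i 0) ^+ 2.
Proof. by rewrite sqr_sqrtr // sumr_ge0 // => i _; rewrite sqr_ge0. Qed.

Lemma norm2Z (R : realType) (d : nat) (a : R) (x : 'cV[R]_d) :
  norm2 (a *: x) = `|a| * norm2 x.
Proof.
rewrite /norm2; under eq_bigr do rewrite mxE exprMn.
by rewrite -mulr_sumr sqrtrM ?sqr_ge0 // sqrtr_sqr.
Qed.

Lemma norm2_0 (R : realType) (d : nat) : norm2 (0 : 'cV[R]_d) = 0.
Proof. by rewrite -(scale0r 0) norm2Z normr0 mul0r. Qed.

Lemma norm2N (R : realType) (d : nat) (x : 'cV[R]_d) :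
  norm2 (- x) = norm2 x.
Proof. by rewrite -scaleN1r norm2Z normrN1 mul1r. Qed.

Lemma norm2_distC (R : realType) (d : nat) (x y : 'cV[R]_d) :
  norm2 (x - y) = norm2 (y - x).
Proof. by rewrite -norm2N opprB. Qed.

Lemma norm2_coord (R : realType) (d : nat) (x : 'cV[R]_d) (i : 'I_d) :
  `|x i 0| <= norm2 x.
Proof.
rewrite -sqrtr_sqr ler_wsqrtr // (bigD1 i) //= lerDl.
by apply: sumr_ge0 => j _; rewrite sqr_ge0.
Qed.

Lemma norm2_delta (R : realType) (d : nat) (i : 'I_d) :
  norm2 (delta_mx i 0 : 'cV[R]_d) = 1.
Proof.
rewrite /norm2 (bigD1 i) //= big1 => [|j /negbTE ji].
  by rewrite mxE !eqxx expr1n addr0 sqrtr1.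
by rewrite mxE ji expr0n.
Qed.

Lemma norm2_eq0 (R : realType) (d : nat) (x : 'cV[R]_d) :
  norm2 x = 0 -> x = 0.
Proof.
move=> x0; apply/matrixP => i j; rewrite ord1 mxE.
by apply/eqP; rewrite -normr_le0 -x0 norm2_coord.
Qed.

(* Expand [0 <= |B x - A y|^2] with [A = |x|] and [B = |y|]. *)
Lemma norm2_cauchy_schwarz (R : realType) (d : nat) (x y : 'cV[R]_d) :
  \sum_i x i 0 * y i 0 <= norm2 x * norm2 y.
Proof.
have [x0|xN0] := eqVneq (norm2 x) 0.
  rewrite x0 mul0r big1 // => i _.
  by rewrite (norm2_eq0 x0) mxE mul0r.
have [y0|yN0] := eqVneq (norm2 y) 0.
  rewrite y0 mulr0 big1 // => i _.
  by rewrite (norm2_eq0 y0) mxE mulr0.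
have A0 : 0 < norm2 x by rewrite lt_neqAle eq_sym xN0 norm2_ge0.
have B0 : 0 < norm2 y by rewrite lt_neqAle eq_sym yN0 norm2_ge0.
have AB0 : 0 < norm2 x * norm2 y by rewrite mulr_gt0.
have : 0 <= \sum_i (norm2 y * x i 0 - norm2 x * y i 0) ^+ 2.
  by apply: sumr_ge0 => i _; exact: sqr_ge0.
have -> : \sum_i (norm2 y * x i 0 - norm2 x * y i 0) ^+ 2 =
    norm2 y ^+ 2 * norm2 x ^+ 2 + norm2 x ^+ 2 * norm2 y ^+ 2 -
    2 * (norm2 x * norm2 y) * \sum_i x i 0 * y i 0.
  rewrite {1}(norm2_sqr x) {2}(norm2_sqr y) !mulr_sumr -sumrN -!big_split /=.
  by apply: eq_bigr => i _; ring.
move=> H; rewrite -(ler_pM2l AB0); nra.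
Qed.

Lemma norm2D (R : realType) (d : nat) (x y : 'cV[R]_d) :
  norm2 (x + y) <= norm2 x + norm2 y.
Proof.
rewrite -(@ler_pXn2r _ 2) ?nnegrE ?addr_ge0 ?norm2_ge0 //.
have -> : norm2 (x + y) ^+ 2 =
    norm2 x ^+ 2 + norm2 y ^+ 2 + 2 * \sum_i x i 0 * y i 0.
  rewrite !norm2_sqr mulr_sumr -!big_split /=.
  by apply: eq_bigr => i _; rewrite mxE; ring.
have := norm2_cauchy_schwarz x y; nra.
Qed.

Lemma norm2B (R : realType) (d : nat) (x y : 'cV[R]_d) :
  norm2 (x - y) <= norm2 x + norm2 y.
Proof. by rewrite -(norm2N y) norm2D. Qed.

(** * Bi-Lipschitz bounds for compositions and shears *)

Lemma lipschitz_const_le (R : realType) (d : nat) (L : R)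
    (F : 'cV[R]_d -> 'cV[R]_d) :
  0 <= L -> lipschitz_with L F -> lipschitz_const F <= L.
Proof. by move=> L0 FL; apply: ge_inf; [exists 0 => M []|]. Qed.

(** One constant serves both directions, since the two bounds of the theorem coincide; it multiplies
    under composition whatever the order of the factors. *)
Definition bilipschitz_with {R : realType} {d : nat} (L : R)
    (F G : 'cV[R]_d -> 'cV[R]_d) : Prop :=
  [/\ 0 <= L, cancel F G, cancel G F, lipschitz_with L F & lipschitz_with L G].

Lemma bilipschitz_with_comp (R : realType) (d : nat) (L L' : R)
    (F G F' G' : 'cV[R]_d -> 'cV[R]_d) :
  bilipschitz_with L F G -> bilipschitz_with L' F' G' ->
  bilipschitz_with (L * L') (F' \o F) (G \o G').
Proof.
move=> [L0 FK GK FL GL] [L'0 F'K G'K F'L G'L]; split.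
- exact: mulr_ge0.
- exact: can_comp.
- exact: can_comp.
- move=> x y; rewrite (mulrC L) -mulrA; apply: le_trans (F'L _ _) _.
  exact: ler_wpM2l.
- move=> x y; rewrite -mulrA; apply: le_trans (GL _ _) _.
  exact: ler_wpM2l.
Qed.

Lemma bilipschitz_with_le (R : realType) (d : nat) (L L' : R)
    (F G : 'cV[R]_d -> 'cV[R]_d) :
  L <= L' -> bilipschitz_with L F G -> bilipschitz_with L' F G.
Proof.
move=> LL' [L0 FK GK FL GL]; split => //; first exact: le_trans LL'.
- by move=> x y; apply: le_trans (FL _ _) _; rewrite ler_wpM2r ?norm2_ge0.
- by move=> x y; apply: le_trans (GL _ _) _; rewrite ler_wpM2r ?norm2_ge0.
Qed.

(** The displacement [h] does not change along itself, so subtracting it undoes adding it; the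
    triangle inequality bounds both maps. *)
Lemma bilipschitz_with_shear (R : realType) (d : nat) (K : R)
    (h : 'cV[R]_d -> 'cV[R]_d) :
  0 <= K -> lipschitz_with K h ->
  (forall x, h (x + h x) = h x) -> (forall x, h (x - h x) = h x) ->
  bilipschitz_with (1 + K) (fun x => x + h x) (fun x => x - h x).
Proof.
move=> K0 hK hD hB; split.
- exact: addr_ge0.
- by move=> x; rewrite hD addrK.
- by move=> x; rewrite hB subrK.
- move=> x y; rewrite opprD addrACA mulrDl mul1r.
  by apply: le_trans (norm2D _ _) _; rewrite lerD2l.
- move=> x y; rewrite opprD addrACA -opprD mulrDl mul1r.
  by apply: le_trans (norm2B _ _) _; rewrite lerD2l.
Qed.

(** * Piecewise linear interpolation by ramps *)

Lemma attainable_translation (R : realType) (d : nat) (v : 'cV[R]_d.+2) :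
  attainable control_family (fun x => x + v).
Proof.
(* Zero weights with biases 1 and 0 make the scalar factor equal to 1. *)
have := @attainable_shear R d 0 0 1 0 v (mul0mx _ _) (mul0mx _ _).
congr attainable; apply/funext => x; rewrite mul0mx mxE !add0r /relu maxxx.
by rewrite max_r ?ler01 // subr0 scale1r.
Qed.

(** The weight on coordinate [i] is negative so that the ramp vanishes to the right of both [a] and
    [b], leaving intact an interpolant built there. *)
Lemma attainable_ramp (R : realType) (d : nat) (i : 'I_d.+2) (a b : R)
    (v : 'cV[R]_d.+2) :
  v i 0 = 0 ->
  attainable control_family
    (fun x => x + (relu (b - x i 0) - relu (a - x i 0)) *: v).
Proof.
move=> vi0; pose p : 'rV[R]_d.+2 := - delta_mx 0 i.
have pE (x : 'cV_d.+2) : p *m x = - row i x by rewrite mulNmx -rowE.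
have pv0 : p *m v = 0.
  by rewrite pE; apply/matrixP => j k; rewrite !ord1 !mxE vi0 oppr0.
have := attainable_shear b a pv0 pv0; congr attainable; apply/funext => x.
by rewrite pE !mxE ![- _ + _]addrC.
Qed.

Lemma relu_sub (R : realType) (a r : R) : relu (a - r) = Num.max r a - r.
Proof.
by rewrite /relu; case: (leP r a) => ra; [rewrite max_r|rewrite max_l]; lra.
Qed.

(* The interpolant is constant to the left of the first node, which the last
   bound encodes. A new first node is prepended by adding a ramp that vanishes
   to the right of the old one; the bounds then telescope. *)
Lemma sorted_interpolation (R : realType) (d : nat) (i : 'I_d.+2) (K : R)
    (T : eqType) (t : T -> R) (v : T -> 'cV[R]_d.+2) (a : T) (s : seq T) :
  0 <= K -> (forall c, v c i 0 = 0) ->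
  path (fun b c => t b <= t c) a s ->
  (forall b c, norm2 (v b - v c) <= K * `|t b - t c|) ->
  exists g : R -> 'cV[R]_d.+2,
    [/\ attainable control_family (fun x => x + g (x i 0)),
        forall c, c \in a :: s -> g (t c) = v c,
        forall r, g r i 0 = 0
      & forall r r', r <= r' ->
          norm2 (g r' - g r) <= K * (Num.max r' (t a) - Num.max r (t a))].
Proof.
move=> K0 vi0 ts vt; elim: s a ts => [|b s IH] a /=.
  move=> _; exists (fun=> v a); split => //.
  - exact: attainable_translation.
  - by move=> c; rewrite inE => /eqP ->.
  - move=> r r' rr'; rewrite subrr norm2_0 mulr_ge0 // subr_ge0.
    by rewrite ge_max !le_max rr' lexx orbT.
move=> /andP[tab ts]; have [g [gA gv gi gK]] := IH b ts.
(* Slope, up to sign, of the new segment. If [t a = t b], the inverse of 0 is 0 and so [w = 0], in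
   agreement with [v a = v b], which [vt] then forces. *)
pose w := (t b - t a)^-1 *: (v a - v b).
have wi0 : w i 0 = 0 by rewrite !mxE !vi0 subrr mulr0.
have wK : norm2 w <= K.
  rewrite norm2Z; have [->|ab] := eqVneq (t b - t a) 0.
    by rewrite invr0 normr0 mul0r.
  have ab0 : 0 < t b - t a by rewrite lt_neqAle eq_sym ab subr_ge0.
  rewrite ger0_norm ?invr_ge0 ?(ltW ab0) // mulrC ler_pdivrMr //.
  by have := vt a b; rewrite distrC ger0_norm // ltW.
have wv : (t b - t a) *: w = v a - v b.
  rewrite scalerA; have [ab|ab] := eqVneq (t b - t a) 0.
    apply/esym; rewrite ab mul0r scale0r; apply: norm2_eq0; apply/eqP.
    rewrite eq_le norm2_ge0 andbT; apply: le_trans (vt a b) _.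
    by rewrite distrC ab normr0 mulr0.
  by rewrite divff // scale1r.
clearbody w; pose rho r := relu (t b - r) - relu (t a - r).
exists (fun r => g r + rho r *: w); split.
(* The ramp acts first; it fixes coordinate [i], so [g] still reads the original value. *)
- have := attainable_comp (attainable_ramp (t a) (t b) wi0) gA.
  congr attainable; apply/funext => x /=.
  by rewrite !mxE wi0 mulr0 addr0 addrAC addrA.
- move=> c; rewrite inE => /orP[/eqP ->|cs].
    (* The old interpolant is constant to the left of [t b], so the ramp only has to supply
       [v a - v b]. *)
    have -> : g (t a) = v b.
      rewrite -(gv b) ?mem_head //; apply/eqP; rewrite eq_sym -subr_eq0.
      apply/eqP/norm2_eq0/eqP; rewrite eq_le norm2_ge0 andbT.
      by have := gK _ _ tab; rewrite maxxx max_r // subrr mulr0.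
    by rewrite /rho subrr {2}/relu maxxx subr0 /relu max_r ?subr_ge0 // wv subrKC.
  have tbc : t b <= t c.
    move: cs; rewrite inE => /orP[/eqP -> //|cs].
    have tr : transitive (fun b c => t b <= t c) by move=> ? ? ?; exact: le_trans.
    by have /allP/(_ _ cs) := order_path_min tr ts.
  rewrite gv // /rho !relu_sub !max_l ?(le_trans tab) //.
  by rewrite !subrr scale0r addr0.
- by move=> r; rewrite !mxE gi wi0 mulr0 addr0.
(* Since [rho r = Num.max r (t b) - Num.max r (t a)], adding [K] times its decrease turns the bound
   truncated at [t b] into the one truncated at [t a]. *)
- move=> r r' rr'; have := gK _ _ rr'.
  rewrite opprD addrACA -scalerBl => gKr.
  apply: le_trans (norm2D _ _) _; rewrite norm2Z.
  have rho_le : rho r' <= rho r.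
    rewrite /rho !relu_sub.
    by case: (leP r (t a)); case: (leP r (t b)); case: (leP r' (t a));
       case: (leP r' (t b)); lra.
  rewrite distrC ger0_norm ?subr_ge0 //.
  have : (rho r - rho r') * norm2 w <= (rho r - rho r') * K.
    by rewrite ler_wpM2l // subr_ge0.
  move: gKr; rewrite /rho !relu_sub => ? ?; lra.
Qed.

(** Sorting the nodes by [t] reduces this to [sorted_interpolation]; truncation by [Num.max] is
    nonexpansive, so the interpolant is [K]-Lipschitz. *)
Lemma lipschitz_interpolation (R : realType) (d : nat) (i : 'I_d.+2) (K : R)
    (T : finType) (t : T -> R) (v : T -> 'cV[R]_d.+2) :
  0 <= K -> (forall c, v c i 0 = 0) ->
  (forall b c, norm2 (v b - v c) <= K * `|t b - t c|) ->
  exists G Ginv : 'cV[R]_d.+2 -> 'cV[R]_d.+2,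
    [/\ attainable control_family G, bilipschitz_with (1 + K) G Ginv
      & forall c (x : 'cV[R]_d.+2), x i 0 = t c -> G x = x + v c].
Proof.
move=> K0 vi0 vt.
case: (pickP (@predT T)) => [c0 _|T0]; last first.
  exists idfun, idfun; split; last by move=> c; have := T0 c.
    have := attainable_translation (0 : 'cV[R]_d.+2); congr attainable.
    by apply/funext => x; rewrite addr0.
  split => //; first exact: addr_ge0.
    by move=> x y; rewrite mulrDl mul1r lerDl mulr_ge0 ?norm2_ge0.
  by move=> x y; rewrite mulrDl mul1r lerDl mulr_ge0 ?norm2_ge0.
pose r := relpre t <=%R.
have : sorted r (sort r (enum T)) by apply: sort_sorted => a b; exact: le_total.
have : forall c, c \in sort r (enum T) by move=> c; rewrite mem_sort mem_enum.
case: (sort r (enum T)) => [/(_ c0)//|a s allT /= ts].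
have [g [gA gv gi gK]] := sorted_interpolation K0 vi0 ts vt.
exists (fun x : 'cV[R]_d.+2 => x + g (x i 0)),
  (fun x : 'cV[R]_d.+2 => x - g (x i 0)); split => //.
  pose h (x : 'cV[R]_d.+2) := g (x i 0).
  apply: (@bilipschitz_with_shear R d.+2 K h) => //; rewrite /h.
  - move=> x y; apply: (@le_trans _ _ (K * `|x i 0 - y i 0|)); last first.
      by rewrite ler_wpM2l //; have := norm2_coord (x - y) i; rewrite !mxE.
    wlog yx : x y / y i 0 <= x i 0.
      move=> H; case: (leP (y i 0) (x i 0)) => [|/ltW] yx; first exact: H.
      by rewrite norm2_distC distrC; exact: H.
    apply: le_trans (gK _ _ yx) _; rewrite ger0_norm ?subr_ge0 // ler_wpM2l //.
    by case: (leP (y i 0) (t a)); case: (leP (x i 0) (t a)); lra.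
  - by move=> x; rewrite mxE gi addr0.
  - by move=> x; rewrite !mxE gi subr0.
by move=> c x xc; rewrite xc gv.
Qed.

(** * Separated nodes and linear shears *)

(** Two values differ by at most [2 * M] while distinct nodes are at least [eta] apart. This crude
    quotient gives the slopes of the second and third shears. *)
Lemma lipschitz_of_separated (R : realType) (d : nat) (T : eqType)
    (t : T -> R) (v : T -> 'cV[R]_d) (M eta : R) (b c : T) :
  0 < eta -> (forall a, norm2 (v a) <= M) ->
  (b != c -> eta <= `|t b - t c|) ->
  norm2 (v b - v c) <= 2 * M / eta * `|t b - t c|.
Proof.
move=> eta0 vM sep; have M0 := le_trans (norm2_ge0 _) (vM b).
have [<-|bc] := eqVneq b c; first by rewrite !subrr norm2_0 normr0 mulr0.
apply: le_trans (norm2B _ _) _; rewrite mulrAC ler_pdivlMr //.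
apply: ler_pM; rewrite ?addr_ge0 ?norm2_ge0 ?(ltW eta0) ?sep //.
by have := vM b; have := vM c; lra.
Qed.

Lemma norm2_kill_coord (R : realType) (d : nat) (z : 'cV[R]_d) (i : 'I_d) :
  norm2 (z - z i 0 *: delta_mx i 0) <= norm2 z.
Proof.
apply: ler_wsqrtr; apply: ler_sum => j _; rewrite !mxE eqxx andbT.
have [->|_] := eqVneq j i; first by rewrite mulr1 subrr expr0n sqr_ge0.
by rewrite mulr0 subr0.
Qed.

(** A linear factor is a difference of two neurons: [relu t - relu (- t) = t]. *)
Lemma attainable_linear_shear (R : realType) (d : nat) (p : 'rV[R]_d.+2)
    (v : 'cV[R]_d.+2) :
  p *m v = 0 ->
  attainable control_family (fun x => x + (p *m x) 0 0 *: v).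
Proof.
move=> pv0; have pv0' : (- p) *m v = 0 by rewrite mulNmx pv0 oppr0.
have := attainable_shear 0 0 pv0 pv0'; congr attainable; apply/funext => x.
have -> : (- p *m x) 0 0 = - (p *m x) 0 0 by rewrite mulNmx mxE.
rewrite !addr0 /relu; congr (_ + _ *: _).
by case: (leP 0 ((p *m x) 0 0)) => h; [rewrite max_l|rewrite max_r]; lra.
Qed.

(** List the indices by increasing [y] and raise the one of rank [k] by [k * eta]: the order is
    kept, and every gap grows by at least [eta]. *)
Lemma separating_perturbation (R : realType) (T : finType) (y : T -> R)
    (eta : R) :
  0 <= eta ->
  exists p : T -> R,
    (forall a, 0 <= p a <= #|T|%:R * eta) /\
    (forall a b, a != b -> eta <= `|(y a + p a) - (y b + p b)|).
Proof.
move=> eta0; pose r := relpre y <=%R; pose s := sort r (enum T).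
have ins a : a \in s by rewrite mem_sort mem_enum.
exists (fun a => (index a s)%:R * eta); split.
  move=> a; rewrite mulr_ge0 //= ler_wpM2r // ler_nat.
  by rewrite cardE -(size_sort r) index_size.
move=> a b ab; wlog iab : a b ab / (index a s < index b s)%N.
  move=> H; case: (ltngtP (index a s) (index b s)) => [|iba|/index_inj eab].
  - exact: H.
  - by rewrite distrC; apply: H; rewrite // eq_sym.
  - by move: ab; rewrite eab // eqxx.
have tr : transitive r by move=> ? ? ?; exact: le_trans.
have yab : y a <= y b.
  apply: (sorted_ltn_index tr) iab => //.
  by apply: sort_sorted => u v; exact: le_total.
have : (index a s).+1%:R * eta <= (index b s)%:R * eta.
  by rewrite ler_wpM2r // ler_nat.
rewrite -addn1 natrD distrC => H; rewrite ger0_norm; lra.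
Qed.

(** * Base-[n] expansions and the first shear *)

(** The last digit is the remainder modulo [n] and the quotient is the expansion of the other
    digits, whence induction on [D]. *)
Lemma base_expansion_inj (n D : nat) (a b : 'I_D -> nat) :
  (forall i, (a i < n)%N) -> (forall i, (b i < n)%N) ->
  (\sum_(i < D) a i * n ^ (D - i.+1) = \sum_(i < D) b i * n ^ (D - i.+1))%N ->
  a =1 b.
Proof.
elim: D a b => [|D IH] a b an bn; first by move=> _ [].
have shift (f : 'I_D.+1 -> nat) :
    (\sum_(i < D.+1) f i * n ^ (D.+1 - i.+1) =
     (\sum_(i < D) f (lift ord_max i) * n ^ (D - i.+1)) * n + f ord_max)%N.
  rewrite big_ord_recr /= subnn muln1 big_distrl /=; congr (_ + _)%N.
  apply: eq_bigr => i _; rewrite -mulnA -expnSr subSS subnSK //.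
  by congr (f _ * _)%N; apply: val_inj; rewrite /= /bump leqNgt ltn_ord.
have n0 : (0 < n)%N by apply: leq_ltn_trans (an ord0).
rewrite !shift => E.
have Em := congr1 (modn^~ n) E; have Ed := congr1 (divn^~ n) E.
move: Em Ed => /=.
rewrite !modnMDl !modn_small // !divnMDl // !divn_small // !addn0 => Em Ed.
move=> i; case: (unliftP ord_max i) => [j ->|->] //.
exact: (IH (fun j => a (lift ord_max j)) (fun j => b (lift ord_max j))).
Qed.

(** Multiplied by [n%:R - 1], the sum telescopes to [1 - n%:R ^- D]. *)
Lemma geometric_sum_le (R : realType) (n D : nat) :
  (2 <= n)%N -> \sum_(j < D) n%:R ^- j.+1 <= (n%:R - 1)^-1 :> R.
Proof.
move=> n2; have n1 : 1 < n%:R :> R by rewrite ltr1n.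
have n1' : 0 < n%:R - 1 :> R by rewrite subr_gt0.
have n0 : n%:R != 0 :> R by rewrite pnatr_eq0; case: n n2 {n1 n1'}.
rewrite -[leRHS]mul1r ler_pdivlMr //.
suff -> : (\sum_(j < D) n%:R ^- j.+1) * (n%:R - 1) = 1 - n%:R ^- D :> R.
  by rewrite gerBl invr_ge0 exprn_ge0.
elim: D => [|D IH]; first by rewrite big_ord0 mul0r expr0 invr1 subrr.
rewrite big_ord_recr /= mulrDl IH exprS invfM; field.
by rewrite n0 expf_neq0.
Qed.

(* At the grid point of [alpha], [x 0 + lex_tail x] is the number in [0, 1[ whose
   base-[n] expansion has digits [alpha 0], [alpha 1], etc. *)
Definition lex_tail (R : realType) (n d : nat) : 'rV[R]_d.+2 :=
  \row_j (if j == ord0 then 0 else n%:R ^- j).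

Lemma lex_tailE (R : realType) (n d : nat) (x : 'cV[R]_d.+2) :
  (lex_tail R n d *m x) 0 0 =
  \sum_(j < d.+1) n%:R ^- j.+1 * x (lift ord0 j) 0.
Proof.
rewrite mxE big_ord_recl mxE eqxx mul0r add0r.
by apply: eq_bigr => j _; rewrite mxE.
Qed.

Lemma lex_tail_delta0 (R : realType) (n d : nat) :
  lex_tail R n d *m (delta_mx ord0 0 : 'cV[R]_d.+2) = 0.
Proof. by apply/matrixP => i j; rewrite -colE !mxE eqxx. Qed.

Lemma lex_tail_le (R : realType) (n d : nat) (x : 'cV[R]_d.+2) (M : R) :
  (2 <= n)%N -> (forall j, `|x j 0| <= M) ->
  `|(lex_tail R n d *m x) 0 0| <= M / (n%:R - 1).
Proof.
move=> n2 xM; have M0 := le_trans (normr_ge0 _) (xM ord0).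
rewrite lex_tailE; apply: le_trans (ler_norm_sum _ _ _) _.
apply: (@le_trans _ _ (M * \sum_(j < d.+1) n%:R ^- j.+1)).
  rewrite mulr_sumr; apply: ler_sum => j _.
  rewrite normrM ger0_norm ?invr_ge0 ?exprn_ge0 // mulrC.
  by rewrite ler_wpM2r ?invr_ge0 ?exprn_ge0.
by rewrite ler_wpM2l // geometric_sum_le.
Qed.

(** The tail does not see coordinate 0, the only one that moves. Its Lipschitz constant is at most
    [1 / (n - 1)] by the geometric sum, and [1 + 1 / (n - 1) = n / (n - 1)] is the first factor of
    the final bound. *)
Lemma lex_shear_bilipschitz (R : realType) (n d : nat) :
  (2 <= n)%N ->
  exists Sinv : 'cV[R]_d.+2 -> 'cV[R]_d.+2,
    bilipschitz_with (n%:R / (n%:R - 1))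
      (fun x => x + (lex_tail R n d *m x) 0 0 *: delta_mx ord0 0) Sinv.
Proof.
move=> n2; have n1 : 0 < n%:R - 1 :> R by rewrite subr_gt0 ltr1n.
pose h (x : 'cV[R]_d.+2) : 'cV[R]_d.+2 :=
  (lex_tail R n d *m x) 0 0 *: delta_mx ord0 0.
have hh a x : h (x + a *: h x) = h x.
  by rewrite /h mulmxDr -!scalemxAr lex_tail_delta0 !scaler0 addr0.
exists (fun x => x - h x).
have -> : n%:R / (n%:R - 1) = 1 + (n%:R - 1)^-1 :> R.
  by field; rewrite gt_eqF.
apply: (@bilipschitz_with_shear R d.+2 (n%:R - 1)^-1 h).
- by rewrite invr_ge0 ltW.
- move=> x y; rewrite /h -scalerBl norm2Z norm2_delta mulr1 [leRHS]mulrC.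
  have -> : (lex_tail R n d *m x) 0 0 - (lex_tail R n d *m y) 0 0 =
      (lex_tail R n d *m (x - y)) 0 0 by rewrite mulmxBr !mxE.
  by apply: lex_tail_le => // j; exact: norm2_coord.
- by move=> x; have := hh 1 x; rewrite scale1r.
- by move=> x; have := hh (-1) x; rewrite scaleN1r.
Qed.

Definition lex_coord (R : realType) (n d : nat)
    (alpha : {ffun 'I_d.+2 -> 'I_n}) : R :=
  grid_point R alpha ord0 0 + (lex_tail R n d *m grid_point R alpha) 0 0.

(** Over the common denominator [n ^ d.+2] the numerator is an integer with digits [alpha j], most
    significant first. *)
Lemma lex_coordE (R : realType) (n d : nat)
    (alpha : {ffun 'I_d.+2 -> 'I_n}) :
  (0 < n)%N ->
  lex_coord R alpha =
  (\sum_(j < d.+2) alpha j * n ^ (d.+2 - j.+1))%:R / (n ^ d.+2)%:R.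
Proof.
move=> n0; have nN0 : n%:R != 0 :> R by rewrite pnatr_eq0 -lt0n.
rewrite /lex_coord lex_tailE natr_sum mulr_suml [RHS]big_ord_recl; congr (_ + _).
  rewrite mxE natrM !natrX subn1 /= (exprS _ d.+1).
  by field; rewrite nN0 expf_neq0.
apply: eq_bigr => j _; rewrite mxE /= natrM !natrX.
have -> : (n%:R ^+ d.+2 : R) =
    n%:R ^+ (d.+2 - (bump 0 j).+1) * (n%:R ^+ j.+1 * n%:R).
  by rewrite -exprSr -exprD subnK // ltnS; exact: ltn_ord.
by field; rewrite nN0 !expf_neq0.
Qed.

(** The numerators of distinct grid points are distinct integers, hence at least 1 apart. *)
Lemma lex_coord_separated (R : realType) (n d : nat)
    (alpha beta : {ffun 'I_d.+2 -> 'I_n}) :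
  (0 < n)%N -> alpha != beta ->
  (n ^ d.+2)%:R^-1 <= `|lex_coord R alpha - lex_coord R beta|.
Proof.
move=> n0 ab; have N0 : 0 < (n ^ d.+2)%:R :> R by rewrite ltr0n expn_gt0 n0.
rewrite !lex_coordE // -mulrBl normrM [`|_^-1|]ger0_norm ?invr_ge0 ?(ltW N0) //.
apply: ler_peMl; first by rewrite invr_ge0 ltW.
set A := (\sum_(j < _) _)%N; set B := (\sum_(j < _) _)%N.
have AB : A != B.
  apply: contra ab => /eqP E; apply/eqP/ffunP => i; apply: val_inj.
  by apply: (base_expansion_inj _ _ E) i => i; exact: ltn_ord.
case: (ltngtP A B) AB => // AB _.
  rewrite distrC ger0_norm ?subr_ge0 ?ler_nat 1?ltnW //.
  by rewrite -natrB 1?ltnW // ler1n subn_gt0.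
rewrite ger0_norm ?subr_ge0 ?ler_nat 1?ltnW //.
by rewrite -natrB 1?ltnW // ler1n subn_gt0.
Qed.

Lemma grid_point_le (R : realType) (n d : nat)
    (alpha : {ffun 'I_d -> 'I_n}) (j : 'I_d) :
  `|grid_point R alpha j 0| <= (n%:R - 1) / n%:R.
Proof.
have n0 : (0 < n)%N by apply: leq_ltn_trans (ltn_ord (alpha j)).
rewrite mxE ger0_norm ?divr_ge0 // ler_wpM2r ?invr_ge0 //.
by rewrite -(natrB _ n0) ler_nat subn1 -ltnS prednK.
Qed.

(** * Combination of the three shears *)

Theorem theorem2p1 (R : realType) (d n : nat) (F : 'cV[R]_d -> 'cV[R]_d)
    (eps : R) :
  (2 <= d)%N -> (2 <= n)%N -> bilipschitz F -> 0 < eps ->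
  let N : R := (n ^ d)%:R in
  let c : R := max_displacement n F + n%:R^-1 in
  let bound : R :=
    n%:R / (n%:R - 1) * (1 + 6 * N * c) * (1 + 2 * N * eps)
      * (1 + 6 * N * eps^-1 * c) in
  exists Fnn Fnn_inv : 'cV[R]_d -> 'cV[R]_d,
    [/\ attainable control_family Fnn,
        bilipschitz_pair Fnn Fnn_inv,
        forall alpha : {ffun 'I_d -> 'I_n},
          norm2 (Fnn (grid_point R alpha) - F (grid_point R alpha)) < eps,
        lipschitz_const Fnn <= bound
      & lipschitz_const Fnn_inv <= bound].
Proof.
case: d F => [|[|d]] F // _ n2 _ eps0 N c bound.
pose X := {ffun 'I_d.+2 -> 'I_n}.
pose x (a : X) := grid_point R a; pose y a := F (x a).
pose e0 : 'cV[R]_d.+2 := delta_mx ord0 0.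
pose i1 : 'I_d.+2 := lift ord0 ord0.
pose e1 : 'cV[R]_d.+2 := delta_mx i1 0.
pose disp : R := max_displacement n F.
have dispP a : norm2 (y a - x a) <= disp.
  exact: (le_bigmax 0 (fun a : X => norm2 (y a - x a)) a).
have n0 : (0 < n)%N by apply: ltn_trans n2.
have nR0 : 0 < n%:R :> R by rewrite ltr0n.
have disp0 : 0 <= disp by apply: bigmax_ge_id.
have N1 : 1 <= N by rewrite ler1n expn_gt0 n0.
have N0 : 0 < N by apply: lt_le_trans N1.
have c_disp : disp <= c by rewrite lerDl invr_ge0 ltW.
(* There are [N] grid points, so perturbations of at most [N * eta] stay within [eps / 3]. *)
pose eta := eps / (3 * N).
have eta0 : 0 < eta by rewrite divr_gt0 // mulr_gt0.
have [p [p_le p_sep]] := separating_perturbation (fun a : X => y a i1 0) (ltW eta0).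
have p_lt a : 0 <= p a <= eps / 3.
  have := p_le a; rewrite card_ffun !card_ord -/N.
  by have -> : N * eta = eps / 3 by rewrite /eta; field; rewrite gt_eqF.
(* Displacement of the second shear: coordinate 0 is removed because it drives this shear. *)
pose v (a : X) := (y a - x a) - (y a - x a) ord0 0 *: e0 + p a *: e1.
have v0 a : v a ord0 0 = 0 by rewrite /v /e0 /e1 !mxE eqxx /=; ring.
have v_le a : norm2 (v a) <= disp + eps.
  apply: le_trans (norm2D _ _) _; apply: lerD.
    exact: le_trans (norm2_kill_coord _ _) (dispP a).
  rewrite norm2Z norm2_delta mulr1; have := p_lt a => /andP[p0 p1].
  by rewrite ger0_norm //; lra.
pose t (a : X) := lex_coord R a.
have vt a b : norm2 (v a - v b) <= 2 * (disp + eps) / N^-1 * `|t a - t b|.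
  apply: lipschitz_of_separated; rewrite ?invr_gt0 //.
  exact: lex_coord_separated.
have K0 : 0 <= 2 * (disp + eps) / N^-1.
  by rewrite divr_ge0 ?invr_ge0 ?(ltW N0) // mulr_ge0 // addr_ge0 // ltW.
have [G2 [G2inv [G2A G2L G2E]]] := lipschitz_interpolation K0 v0 vt.
pose w (a : X) := (y a ord0 0 - t a) *: e0.
have w1 a : w a i1 0 = 0 by rewrite /w /e0 !mxE mulr0.
(* The tail of a grid point is at most [((n - 1) / n) / (n - 1) = 1 / n]; this accounts for the term
   [n%:R^-1] in [c]. *)
have w_le a : norm2 (w a) <= c.
  rewrite norm2Z norm2_delta mulr1 /t /lex_coord opprD addrA.
  apply: le_trans (ler_normB _ _) _; apply: lerD.
    have := norm2_coord (y a - x a) ord0; rewrite !mxE => h.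
    exact: le_trans h (dispP a).
  have := lex_tail_le n2 (@grid_point_le R n _ a); congr (_ <= _).
  by field; rewrite !gt_eqF // subr_gt0 ltr1n.
pose t' (a : X) := y a i1 0 + p a.
have wt a b : norm2 (w a - w b) <= 2 * c / eta * `|t' a - t' b|.
  by apply: lipschitz_of_separated => // ab; exact: p_sep.
have K'0 : 0 <= 2 * c / eta.
  by rewrite divr_ge0 ?(ltW eta0) // mulr_ge0 // (le_trans disp0).
have [G3 [G3inv [G3A G3L G3E]]] := lipschitz_interpolation K'0 w1 wt.
have [Sinv SL] := lex_shear_bilipschitz R d n2.
set S := (fun x => _) in SL.
have SA : attainable control_family S.
  exact: attainable_linear_shear (lex_tail_delta0 R n d).
have Gx a : G3 (G2 (S (x a))) = y a + p a *: e1.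
  have Sx : S (x a) ord0 0 = t a.
    by rewrite /S mxE [X in _ + X]mxE [delta_mx _ _ _ _]mxE eqxx mulr1.
  rewrite (G2E a) //.
  have E : S (x a) + v a + w a = y a + p a *: e1.
    rewrite /w /t /lex_coord /v /S -/(x a) -/e0.
    by apply/matrixP => i j; rewrite !mxE; ring.
  (* As [w] vanishes in coordinate 1, [E] also shows that the point entering [G3] has coordinate 1
     equal to the node [t' a]. *)
  have E1 := congr1 (fun z : 'cV[R]_d.+2 => z i1 0) E.
  rewrite (G3E a) //; move: E1; rewrite [_ i1 0]mxE w1 addr0 => ->.
  by rewrite /e1 !mxE eqxx mulr1.
have L : bilipschitz_with bound (G3 \o (G2 \o S)) ((Sinv \o G2inv) \o G3inv).
  have := bilipschitz_with_comp (bilipschitz_with_comp SL G2L) G3L.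
  apply: bilipschitz_with_le.
  have -> : 1 + 2 * c / eta = 1 + 6 * N * eps^-1 * c.
    by rewrite /eta; field; rewrite !gt_eqF.
  rewrite ler_wpM2r //.
    rewrite addr_ge0 // !mulr_ge0 ?invr_ge0 ?(ltW N0) ?(ltW eps0) //.
    exact: le_trans c_disp.
  rewrite -[leRHS]mulrA ler_wpM2l //; first by rewrite divr_ge0 // subr_ge0 ler1n.
  (* What remains is [1 + 2 N (disp + eps) <= (1 + 6 N c) (1 + 2 N eps)]; expanding the right side,
     [disp <= c] and nonnegativity of the cross term suffice. *)
  rewrite invrK; have : 0 <= N * c * (N * eps).
    by rewrite !mulr_ge0 ?(ltW N0) ?(ltW eps0) // (le_trans disp0).
  have : N * disp <= N * c by rewrite ler_wpM2l // ltW.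
  have : 0 <= N * disp by rewrite mulr_ge0 // ltW.
  by lra.
case: L => bound0 GK GinvK GL GinvL.
exists (G3 \o (G2 \o S)), ((Sinv \o G2inv) \o G3inv); split.
- exact: attainable_comp (attainable_comp SA G2A) G3A.
- by split => //; exists bound.
- move=> a; rewrite /= Gx addrAC subrr add0r norm2Z norm2_delta mulr1.
  by have /andP[? ?] := p_lt a; rewrite ger0_norm //; lra.
- exact: lipschitz_const_le.
- exact: lipschitz_const_le.
Qed.
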